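(* Let $n_1,\ldots,n_k$ be positive integers, and let $R_1,\ldots,R_k$ be finite subsets of $\mathbb{Z}$. For $s=1,\ldots,k$, let $c_{st}\in\mathbb{C}$ for each $t\in R_s$, and set $$X_s=\Big\{x\in\mathbb{Z}:\ \sum_{t\in R_s}c_{st}e^{2\pi i\frac{t}{n_s}x}=0\Big\}.$$ Let $1\le m\le k$ be an integer and put $$W=\max_{\substack{I\subseteq\{1,\ldots,k\}\\ |I|=k-m+1}}\Big|\Big\{\Big\{\sum_{s\in I}\frac{r_s}{n_s}\Big\}:\ r_s\in R_s \text{ for } s\in I\Big\}\Big|,$$ so that $W\le \max_{I\subseteq\{1,\ldots,k\},\,|I|=k-m+1}\prod_{s\in I}|R_s|$. If the system $\{X_s\}_{s=1}^k$ covers $W$ consecutive integers at least $m$ times, then it covers every integer at least $m$ times.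
   Context: For a real number $x$, $\{x\}$ denotes its fractional part; in the definition of $W$ the outer braces denote a set and the inner braces the fractional part. The system $\{X_s\}_{s=1}^k$ covers an integer $x$ at least $m$ times if $|\{1\le s\le k:\ x\in X_s\}|\ge m$. *)

(* Defs.v *)
From HB Require Import structures.
From mathcomp Require Import all_boot all_order all_algebra finmap.
From mathcomp Require Import complex.
From mathcomp Require Import boolp classical_sets functions cardinality reals.
From mathcomp Require Import topology normedtype sequences exp trigo.

Set Implicit Arguments.
Unset Strict Implicit.
Unset Printing Implicit Defensive.
Import Order.TTheory GRing.Theory Num.Theory.

Local Open Scope classical_set_scope.
Local Open Scope ring_scope.
Local Open Scope complex_scope.

Section Definitions.
Variable R : realType.

Definition cexp (z : R[i]) : R[i] :=
  (expR (complex.Re z))%:C * (cos (complex.Im z) +i* sin (complex.Im z)).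

Definition frac (x : R) : R := x - (Num.floor x)%:~R.

Definition expsum_zeros (n : nat) (A : {fset int}) (c : int -> R[i]) :
    set int :=
  [set x : int |
    \sum_(t <- A) c t * cexp (2 * pi%:C * 'i%C * (t%:~R / n%:R) * x%:~R) = 0].

Definition covers (k : nat) (X : 'I_k -> set int) (m : nat) (x : int) : Prop :=
  (m <= #|[set s : 'I_k | x \in X s]%SET|)%N.

(* The values of r outside I are unconstrained and irrelevant: r stands for a
   family (r_s)_{s in I}. *)
Definition frac_sums (k : nat) (n : 'I_k -> nat) (A : 'I_k -> {fset int})
    (I : {set 'I_k}) : set R :=
  [set frac (\sum_(s in I) (r s)%:~R / (n s)%:R) |
    r in [set r : 'I_k -> int | forall s, s \in I -> r s \in A s]].

(* fset_set returns fset0 on infinite sets; this shows that the default is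
   never used in W_bound below. *)
Lemma finite_frac_sums (k : nat) (n : 'I_k -> nat) (A : 'I_k -> {fset int})
  (I : {set 'I_k}) : finite_set (frac_sums n A I).
Proof.
pose D := [set r : 'I_k -> int | forall s, s \in I -> r s \in A s].
pose g (r : 'I_k -> int) s : R := (r s)%:~R / (n s)%:R.
have H (l : seq 'I_k) :
    finite_set [set \sum_(s <- l | s \in I) g r s | r in D].
  elim: l => [|a l IHl].
    apply: (@sub_finite_set _ _ [set 0]); last exact: finite_set1.
    by move=> _ [r _ <-]; rewrite big_nil.
  case: (boolP (a \in I)) => aI; last first.
    apply: sub_finite_set IHl => _ [r Dr <-]; exists r => //.
    by rewrite big_cons (negbTE aI).
  have fA : finite_set [set (z%:~R / (n a)%:R : R) | z in [set` A a]].
    exact/finite_image/finite_fset.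
  apply: sub_finite_set (finite_image2 (fun x y => x + y) fA IHl).
  move=> _ [r Dr <-]; rewrite big_cons aI.
  exists (g r a); first by exists (r a) => //=; exact: Dr.
  by exists (\sum_(s <- l | s \in I) g r s) => //; exists r.
apply: sub_finite_set (finite_image frac (H (index_enum _))).
by move=> _ [r Dr <-]; exists (\sum_(s in I) g r s) => //; exists r.
Qed.

Definition W_bound (k : nat) (n : 'I_k -> nat) (A : 'I_k -> {fset int})
    (m : nat) : nat :=
  \max_(I : {set 'I_k} | #|I| == (k - m + 1)%N) #|` fset_set (frac_sums n A I)|.

End Definitions.

Arguments W_bound R {k} n A m.

(* Main.v *)
Require Import Defs.
From mathcomp Require Import all_boot all_order all_algebra finmap zify.
From mathcomp Require Import complex.
From mathcomp Require Import classical_sets reals.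
From mathcomp Require Import cardinality exp trigo.

(** Write f_s for the exponential sum whose integer zeros are X_s.  An integer x
    lies in at least m of the k sets exactly when no k - m + 1 of the sets all
    miss it, that is, when for every index set I of size k - m + 1 the product
    of the f_s over s in I vanishes at x (coversP).  It is therefore enough to
    treat one such product at a time.

    Expanding the product gives a linear combination of the functions
    e^(2 pi i y x), one for every choice of a frequency r_s in each R_s, with
    y = sum r_s / n_s.  Since x is an integer, only the fractional part of y
    matters, so at most W distinct exponentials occur (prod_expsum).

    A linear combination of w functions x -> z^x with z nonzero satisfies a
    linear recurrence of order w whose lowest and highest coefficients are
    invertible, so w consecutive zeros propagate to all integers in both
    directions (expsum_eq0).  The product thus vanishes everywhere, for every
    I, and x is covered at least m times.

    The comparison of W with the product of the |R_s| counts the same choices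
    of frequencies before their sums are reduced modulo 1
    (card_frac_sums_le). *)

Set Implicit Arguments.
Unset Strict Implicit.
Unset Printing Implicit Defensive.
Import Order.TTheory GRing.Theory Num.Theory.

Local Open Scope ring_scope.

(** * Exponential sums vanishing on consecutive integers *)

(** The zero at a moves to the right by the relation itself, and to the left by
    cancelling z. *)
Lemma geometric_eq0 (F : idomainType) (z : F) (u : int -> F) (a : int) :
  z != 0 -> (forall x, u (x + 1) = z * u x) -> u a = 0 -> forall x, u x = 0.
Proof.
move=> z0 uS ua0.
have up j : u (a + j%:Z) = 0.
  elim: j => [|j IHj]; first by rewrite addr0.
  by rewrite -addn1 PoszD addrA uS IHj mulr0.
have down j : u (a - j%:Z) = 0.
  elim: j => [|j IHj]; first by rewrite subr0.
  apply/eqP; have /eqP := uS (a - j.+1%:Z).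
  rewrite -addn1 PoszD opprD addrA subrK IHj eq_sym mulf_eq0.
  by rewrite (negbTE z0).
move=> x; rewrite -(subrK a x) addrC.
by case: (x - a) => j; [exact: up | rewrite NegzE; exact: down].
Qed.

(** By induction on the number of terms: if z is the ratio of the first term,
    then u(x + 1) - z u(x) is an exponential sum with one term fewer, which
    vanishes at all but the last of the given integers.  So it vanishes
    identically, and u is geometric with a zero. *)
Lemma expsum_eq0 (F : idomainType) (T : Type) (z : T -> F) (e : T -> int -> F)
    (S : seq T) (C : T -> F) (a : int) :
    (forall t, z t != 0) -> (forall t x, e t (x + 1) = z t * e t x) ->
    (forall j, (j < size S)%N -> \sum_(t <- S) C t * e t (a + j%:Z) = 0) ->
  forall x, \sum_(t <- S) C t * e t x = 0.
Proof.
move=> z0 eS; elim: S C => [|t S IHS] C u0 x; first by rewrite big_nil.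
have diff y : \sum_(i <- S) (C i * (z i - z t)) * e i y
    = (\sum_(i <- t :: S) C i * e i (y + 1)) -
      z t * \sum_(i <- t :: S) C i * e i y.
  rewrite mulr_sumr -sumrB big_cons eS mulrCA subrr add0r.
  apply: eq_bigr => i _.
  by rewrite eS mulrBr mulrBl -!mulrA [z t * (_ * _)]mulrCA.
have diff0 := IHS (fun i => C i * (z i - z t)).
apply: (geometric_eq0 (z0 t) (u := fun y => \sum_(i <- t :: S) C i * e i y)
  (a := a)) => [y|]; last by rewrite -[a]addr0 u0.
apply/eqP; rewrite -subr_eq0 -diff; apply/eqP/diff0 => j jS.
by rewrite diff (u0 j) 1?ltnW // mulr0 subr0 -addrA -PoszD addn1 u0.
Qed.

(** * The additive character *)

Section Character.
Variable R : realType.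
Local Open Scope complex_scope.

Definition chi (y : R) : R[i] :=
  (cos (2 * pi * y) +i* sin (2 * pi * y))%C.

Lemma chi0 : chi 0 = 1.
Proof. by rewrite /chi mulr0 cos0 sin0. Qed.

Lemma chiD (y z : R) : chi (y + z) = chi y * chi z.
Proof.
rewrite /chi mulrDr cosD sinD; apply/eqP; rewrite eq_complex /=.
by rewrite eqxx /= addrC.
Qed.

Lemma chi_neq0 (y : R) : chi y != 0.
Proof.
apply/eqP => y0; have := chiD y (- y).
by rewrite subrr chi0 y0 mul0r => /eqP; rewrite oner_eq0.
Qed.

Lemma chi_int (j : int) : chi j%:~R = 1.
Proof.
have chi1 : chi 1 = 1.
  by rewrite /chi mulr1 mulr_natl cos2pi sin2pi.
have chin (n : nat) : chi n%:R = 1.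
  by elim: n => [|n IHn]; rewrite ?chi0 // -natr1 chiD IHn chi1 mulr1.
case: j => n; first exact: chin.
by rewrite NegzE mulrNz -[LHS]mul1r -{1}(chin n.+1) -chiD pmulrn subrr chi0.
Qed.

Lemma chi_frac (y : R) (x : int) :
  chi (Defs.frac y * x%:~R) = chi (y * x%:~R).
Proof.
by rewrite /Defs.frac mulrBl -intrM -[RHS]mulr1 -(chi_int (- (Num.floor y * x)))
  -chiD mulrNz.
Qed.

Lemma chi_sum (I : finType) (P : pred I) (y : I -> R) :
  chi (\sum_(i | P i) y i) = \prod_(i | P i) chi (y i).
Proof. exact: (big_morph chi chiD chi0). Qed.

Lemma cexp_chi (n : nat) (t x : int) :
  cexp (2 * pi%:C * 'i%C * (t%:~R / n%:R) * x%:~R)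
  = chi ((t%:~R / n%:R) * x%:~R) :> R[i].
Proof.
have -> : 2 * pi%:C * 'i%C * (t%:~R / n%:R) * x%:~R
    = 'i%C * (2 * pi * (t%:~R / n%:R * x%:~R))%:C :> R[i].
  rewrite !rmorphM fmorphV !rmorph_int !rmorph_nat.
  by rewrite -!mulrA [RHS]mulrCA [X in _ = _ * X]mulrCA.
rewrite /cexp /chi; set w := 2 * pi * _.
have -> : 'i%C * w%:C = (0 +i* w)%C :> R[i].
  apply/eqP; rewrite eq_complex /=.
  by rewrite !(mul0r, mul1r, mulr0, addr0, add0r, oppr0) !eqxx.
by rewrite /= expR0 mul1r.
Qed.

End Character.

(** * Choosing one frequency from each set *)

Section Choices.
Variables (k : nat) (A : 'I_k -> {fset int}).

(** One finite type holding all the A s lets the choices be finite functions;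
    the added 0 provides a default value even when every A s is empty. *)
Definition all_freqs : {fset int} := (0 |` \bigcup_(s <- enum 'I_k) A s)%fset.

Definition freq0 : all_freqs := FSetSub (fset1U1 0 _).

Definition choices (I : {set 'I_k}) : {pred {ffun 'I_k -> all_freqs}} :=
  pfamily freq0 (mem I) (fun s b => val b \in A s).

Lemma sub_all_freqs (s : 'I_k) : (A s `<=` all_freqs)%fset.
Proof. by rewrite fsubsetU // bigfcup_sup ?orbT ?mem_enum. Qed.

Lemma big_all_freqs (T : Type) (idx : T) (op : Monoid.com_law idx)
    (F : int -> T) (s : 'I_k) :
  \big[op/idx]_(t <- A s) F t
  = \big[op/idx]_(b : all_freqs | val b \in A s) F (val b).
Proof.
rewrite -(big_seq_fsetE op all_freqs (fun t => t \in A s) F) /=.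
rewrite [RHS]big_mkcond.
rewrite -(big_fset_incl op (sub_all_freqs s)) => [|t _ /negbTE -> //].
by apply: eq_big_seq => t ->.
Qed.

Lemma card_choices (I : {set 'I_k}) :
  #|choices I| = (\prod_(s in I) #|` A s|)%N.
Proof.
rewrite /choices card_pfamily foldrE big_map big_enum /=.
apply: eq_bigr => s _; rewrite -sum1_card -(big_all_freqs _ (fun=> 1%N)).
by rewrite big_const_seq count_predT iter_addn_0 mul1n.
Qed.

End Choices.

Arguments freq0 {k} A.
Arguments choices {k} A I.

(** * Products of the exponential sums *)

Section Products.
Variables (R : realType) (k : nat) (n : 'I_k -> nat) (A : 'I_k -> {fset int}).
Variable c : 'I_k -> int -> R[i]%C.

Definition choice_freq (I : {set 'I_k}) (f : {ffun 'I_k -> all_freqs A}) : R :=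
  Defs.frac (\sum_(s in I) (val (f s))%:~R / (n s)%:R).

Lemma choice_freq_in (I : {set 'I_k}) f : f \in choices A I ->
  choice_freq I f \in fset_set (frac_sums n A I).
Proof.
move=> /pfamilyP[_ fA]; rewrite in_fset_set; last exact: finite_frac_sums.
by rewrite inE; exists (fun s => val (f s)) => // s sI; exact: fA.
Qed.

Lemma card_frac_sums_le (I : {set 'I_k}) :
  (#|` fset_set (@frac_sums R k n A I)| <= \prod_(s in I) #|` A s|)%N.
Proof.
rewrite -card_choices.
apply: (@leq_trans #|` [fset choice_freq I f | f in choices A I]%fset|);
  last by rewrite (leq_trans (leq_imfset_card _ _ _)) //= cardE.
apply/fsubset_leq_card/fsubsetP => y.
rewrite in_fset_set; last exact: finite_frac_sums.
rewrite inE => -[r /= rA <-].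
pose f := [ffun s => if s \in I then insubd (freq0 A) (r s) else freq0 A].
have fr s : s \in I -> val (f s) = r s.
  move=> sI; rewrite ffunE sI val_insubd.
  by rewrite (fsubsetP (sub_all_freqs A s)) // rA.
apply/imfsetP; exists f => /=; last first.
  by rewrite /choice_freq; congr Defs.frac; apply: eq_bigr => s sI; rewrite fr.
apply/pfamilyP; split.
  apply/fintype.subsetP => s; apply: contraR => sI.
  by rewrite ffunE (negbTE sI).
by move=> s sI; rewrite unfold_in fr // rA.
Qed.

Definition expsum (s : 'I_k) (x : int) : R[i]%C :=
  \sum_(t <- A s) c s t * chi ((t%:~R / (n s)%:R) * x%:~R).

Definition prod_coef (I : {set 'I_k}) (y : R) : R[i]%C :=
  \sum_(f in choices A I | choice_freq I f == y) \prod_(s in I) c s (val (f s)).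

(** Expanding the product gives one character per choice of frequencies.  At an
    integer x the character depends on the total frequency modulo 1 only, so
    the terms can be collected by fractional part. *)
Lemma prod_expsum (I : {set 'I_k}) (x : int) :
  \prod_(s in I) expsum s x
  = \sum_(y <- fset_set (frac_sums n A I)) prod_coef I y * chi (y * x%:~R).
Proof.
under eq_bigr => s _ do rewrite /expsum big_all_freqs.
rewrite (big_distr_big_dep (freq0 A)) /=.
under [RHS]eq_bigr => y _ do rewrite /prod_coef big_distrl.
rewrite (exchange_big_dep (fun f => f \in choices A I)) /=; last first.
  by move=> y f _ /andP[].
apply: eq_bigr => f fI.
under [RHS]eq_bigl => y do rewrite fI eq_sym.
rewrite (fbig_pred1_inj _ _ (choice_freq_in fI) (k := id)) //.
by rewrite big_split /= -chi_sum -mulr_suml /choice_freq chi_frac.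
Qed.

(** Each character satisfies chi (y (x + 1)) = chi y * chi (y x), so the
    collected form of the product is covered by the vanishing criterion. *)
Lemma prod_expsum_eq0 (I : {set 'I_k}) (W : nat) (a : int) :
    (#|` fset_set (@frac_sums R k n A I)| <= W)%N ->
    (forall j, (j < W)%N -> \prod_(s in I) expsum s (a + j%:Z) = 0) ->
  forall x, \prod_(s in I) expsum s x = 0.
Proof.
move=> leW van x; rewrite prod_expsum.
apply: (@expsum_eq0 _ _ (@chi R) (fun y x => chi (y * x%:~R)) _ _ a).
- exact: chi_neq0.
- by move=> y j; rewrite intrD mulrDr mulr1 addrC chiD.
- by move=> j jS; rewrite -prod_expsum van // (leq_trans jS).
Qed.

End Products.

(** * Multiple covering *)

(** The indices of the sets that miss x form the complement of those that
    cover it; m covers leave at most k - m misses, too few to fill any I, and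
    otherwise some I can be drawn from the misses. *)
Lemma coversP (k : nat) (X : 'I_k -> set int) (m : nat) (x : int) :
    (m <= k)%N ->
  covers X m x <->
  (forall I : {set 'I_k}, #|I| = (k - m + 1)%N -> exists2 s, s \in I & X s x).
Proof.
move=> mk; rewrite /covers; set N := [set s | _]%SET.
have cardN := cardsC N; rewrite card_ord in cardN.
split=> [mN I cI | allI].
  suff /subsetPn[s sI sN] : ~~ (I \subset ~: N).
    by exists s => //; move: sN; rewrite !inE negbK => /set_mem.
  apply/negP => /subset_leq_card; rewrite cI.
  by move: #|N| #|~: N| cardN mN => u v; lia.
rewrite leqNgt; apply/negP => Nm.
have kN : (k - m + 1 <= #|~: N|)%N by lia.
have [I] : exists I, I \in
    [set I : {set 'I_k} | I \subset ~: N & #|I| == (k - m + 1)%N]%SET.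
  by apply/card_gt0P; rewrite cards_draws bin_gt0.
rewrite inE => /andP[IN /eqP /allI[s sI Xs]].
by have := fintype.subsetP IN s sI; rewrite !inE => /negP; apply; apply/mem_set.
Qed.

Theorem theorem1p2 (R : realType) (k : nat) (n : 'I_k -> nat)
    (A : 'I_k -> {fset int}) (c : 'I_k -> int -> complex R) (m : nat)
    (n_gt0 : forall s : 'I_k, (0 < n s)%N) (m_gt0 : (1 <= m)%N)
    (m_le_k : (m <= k)%N) :
  let X : 'I_k -> set int := fun s => expsum_zeros (n s) (A s) (c s) in
  let W := W_bound R n A m in
  (W <= \max_(I : {set 'I_k} | #|I| == (k - m + 1)%N)
          \prod_(s in I) #|` A s|)%N
  /\ ((exists a : int, forall j : nat, (j < W)%N -> covers X m (a + j%:Z)%R) ->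
      forall x : int, covers X m x).
Proof.
move=> X W; split.
  apply/bigmax_leqP => I cI.
  exact: leq_trans (card_frac_sums_le R n A I) (leq_bigmax_cond _ cI).
have XE s x : X s x <-> expsum n A c s x = 0.
  by rewrite /X /expsum_zeros /=; under eq_bigr => t _ do rewrite cexp_chi.
have prod0 (I : {set 'I_k}) x :
    \prod_(s in I) expsum n A c s x = 0 <-> exists2 s, s \in I & X s x.
  split=> [/eqP/prodf_eq0[s sI /eqP/XE Xs]|[s sI /XE Xs]]; first by exists s.
  by apply/eqP/prodf_eq0; exists s => //; apply/eqP.
move=> [a cov] x; apply/(coversP _ _ m_le_k) => I cI; apply/prod0.
apply: (prod_expsum_eq0 (W := W) (a := a)) => [|j jW].
  by rewrite /W /W_bound (leq_bigmax_cond I) // cI.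
apply/prod0; have [covI _] := coversP X (a + j%:Z) m_le_k.
exact: covI (cov j jW) I cI.
Qed.
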